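(* Let $G$ be an infinite group with a finite generating set $X$ such that the spherical growth series $s_{G,X}(t)=\sum_{n=0}^\infty |S_{G,X}(n)|\,t^n$ is a rational function. Then there exist constants $\alpha \in \mathbb{Z}_{\geq 0}$, $\lambda \in [1,\infty)$ and $D > C > 0$ such that $$C n^\alpha \lambda^n \leq |S_{G,X}(n)| \leq D n^\alpha \lambda^n$$ for all $n \geq 1$.
   Context: For a group $G$ with a finite generating set $X$ and $g\in G$, $|g|_X$ denotes the word length of $g$ with respect to $X$, i.e. the minimal length of a word over $X\cup X^{-1}$ representing $g$. For $n \in \mathbb{Z}_{\geq 0}$, $S_{G,X}(n) = \{ g \in G \mid |g|_X = n\}$ is the sphere of radius $n$. A power series is a rational function if it is (the expansion at $0$ of) a ratio of two polynomials. *)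

(* Defs.v *)
From mathcomp Require Import all_boot all_order all_algebra.
From mathcomp Require Import finmap.
From mathcomp Require Import boolp classical_sets cardinality reals.
From mathcomp Require Import complex.

Set Implicit Arguments.
Unset Strict Implicit.
Unset Printing Implicit Defensive.

Import Order.TTheory GRing.Theory Num.Theory.

Local Open Scope ring_scope.

Section Growth.
Context {G : groupType}.
Implicit Types (X : {fset G}) (w : seq G) (g : G) (n : nat).

Definition is_word X w : bool := all (fun x => (x \in X) || (x^-1%g \in X)) w.

Definition represents w g : bool := (\prod_(x <- w) x)%g == g.

Definition has_word_of_size X g n : Prop :=
  exists w, [/\ is_word X w, represents w g & size w = n].

Definition generates X : Prop := forall g, exists n, has_word_of_size X g n.

(* The value 0 in the second branch is a dummy: that branch is never taken when
   X generates G. *)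
Definition word_length X g : nat :=
  if pselect (exists n, `[< has_word_of_size X g n >]) is left ex
  then ex_minn ex else 0%N.

Definition sphere X n : set G := [set g | word_length X g = n]%classic.

(* fset_set sends infinite sets to the empty one, but spheres are finite when
   the finite set X generates G. *)
Definition sphere_size X n : nat := #|` fset_set (sphere X n)|.

End Growth.

(* The series sum_n s_n t^n is p / q: the Cauchy product q * s equals p, with
   q <> 0. Factors of t common to p and q are allowed; since K[[t]] is a
   domain, p and q determine s. *)
Definition rational_series (K : fieldType) (s : nat -> K) : Prop :=
  exists p q : {poly K}, q != 0 /\
    forall n, \sum_(i < n.+1) q`_i * s (n - i)%N = p`_n.

(* Main.v *)
Require Import Defs.
From mathcomp Require Import all_boot all_order all_algebra.
From mathcomp Require Import finmap.
From mathcomp Require Import boolp classical_sets cardinality reals.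
From mathcomp Require Import complex.
From mathcomp Require Import ring lra.

Set Implicit Arguments.
Unset Strict Implicit.
Unset Printing Implicit Defensive.

Import Order.TTheory GRing.Theory Num.Theory.
Import ComplexField.Normc.

Local Open Scope ring_scope.

(** Write a_n for the size of the n-th sphere.  Two facts about the group are
enough.  A geodesic of length m + n splits into geodesics of lengths m and n, so
a_(m+n) <= a_m a_n (sphere_size_submul); and a prefix of a geodesic is a
geodesic, so in an infinite group no sphere is empty (sphere_size_gt0).  The
rest concerns positive submultiplicative sequences with a rational generating
series (submultiplicative_rational_growth).

Let E be the shift of sequences.  Rationality says that P(E) a = 0 from some
index on, for a polynomial P with nonzero roots (rational_recurrence), so there
a_n is a sum over the roots x of P of p_x(n) x^n, where p_x is a polynomial
(quasi_poly_of_recurrence).  Among the x with p_x <> 0 choose mu such that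
(|mu|, deg p_mu) is lexicographically largest, and put lambda = |mu| and
alpha = deg p_mu.  The upper bound follows term by term.

The dominant terms may cancel one another for some n, so the lower bound needs
submultiplicativity.  Applying E - y often enough kills the term of y and
multiplies p_mu by a nonzero factor, up to terms of lower degree.  Doing this
for all y <> mu gives a polynomial g such that (g(E) a)_n = r(n) mu^n with
deg r = alpha (quasi_poly_isolate).  Hence, for large n,
<<
  c n^alpha lambda^n <= |r(n) mu^n| = |sum_i g_i a_(n+i)|
                     <= (sum_i |g_i| a_i) a_n,
>>
the last step because a_(n+i) <= a_i a_n.  Finally lambda >= 1, since otherwise
the upper bound would tend to 0 while a_n >= 1. *)

(** * The action of a first-order shift on quasi-polynomials *)

Section TwistedDifference.
Context {K : numFieldType}.
Implicit Types (x y : K) (p r : {poly K}).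

(** With E the shift of sequences, E - y maps n |-> r(n) x^n to the sequence
n |-> (twist_diff x y r)(n) x^n. *)
Definition twist_diff x y r : {poly K} := x *: (r \Po ('X + 1)) - y *: r.

Lemma horner_twist_diff x y r n :
  (twist_diff x y r).[n%:R] = x * r.[n.+1%:R] - y * r.[n%:R].
Proof.
by rewrite /twist_diff !hornerE horner_comp !hornerE -natr1.
Qed.

Lemma twist_diffD x y p r :
  twist_diff x y (p + r) = twist_diff x y p + twist_diff x y r.
Proof. by rewrite /twist_diff comp_polyD !scalerDr opprD addrACA. Qed.

Lemma twist_diffZ x y c r : twist_diff x y (c *: r) = c *: twist_diff x y r.
Proof. by rewrite /twist_diff comp_polyZ scalerBr !scalerA ![c * _]mulrC. Qed.

(** The operator is x - y plus x times the forward difference, which lowers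
degrees; the two cases x = y and x <> y are read off from this. *)
Lemma twist_diffE x y p :
  twist_diff x y p = (x - y) *: p + x *: twist_diff 1 1 p.
Proof.
by rewrite /twist_diff !scale1r scalerBr scalerBl [RHS]addrC addrA subrK.
Qed.

Lemma size_twist_diff11 p : (size (twist_diff 1 1 p) <= (size p).-1)%N.
Proof.
rewrite /twist_diff !scale1r.
have [->|p0] := eqVneq p 0; first by rewrite comp_poly0 subrr size_poly0.
have sX : size ('X + 1 : {poly K}) = 2 by rewrite -polyC1 size_XaddC.
have sc : size (p \Po ('X + 1)) = size p by rewrite size_comp_poly2.
have lc : lead_coef (p \Po ('X + 1)) = lead_coef p.
  by rewrite lead_coef_comp ?sX// -polyC1 lead_coefXaddC expr1n mulr1.
apply/leq_sizeP => j; rewrite leq_eqVlt => /predU1P[<-|].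
  by rewrite coefB -{1}sc -!lead_coefE lc subrr.
move=> jp.
by rewrite coefB !nth_default ?subr0 ?sc ?(leq_trans (leqSpred _) jp).
Qed.

Lemma size_twist_diff_neq x y p : x != y -> size (twist_diff x y p) = size p.
Proof.
move=> xy; have xy0 : x - y != 0 by rewrite subr_eq0.
have [->|p0] := eqVneq p 0.
  by rewrite /twist_diff comp_poly0 !scaler0 subrr.
have s0 : (0 < size p)%N by rewrite size_poly_gt0.
rewrite twist_diffE size_polyDl (size_scale p xy0)//.
apply: leq_ltn_trans (size_scale_leq _ _) _.
by rewrite (leq_ltn_trans (size_twist_diff11 _))// prednK.
Qed.

Lemma size_twist_diff_eq x p : (size (twist_diff x x p) <= (size p).-1)%N.
Proof.
rewrite twist_diffE subrr scale0r add0r.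
exact: leq_trans (size_scale_leq _ _) (size_twist_diff11 _).
Qed.

(** For x = y <> 0 the operator is x times the forward difference, which lowers
the degree by exactly one in characteristic 0, so leading terms can be removed
one by one.  For x <> y it is invertible: x - y is a unit and the forward
difference is nilpotent on polynomials of bounded degree. *)
Lemma twist_diff_surj x y p : (x != 0) || (x != y) ->
  exists r, twist_diff x y r = p.
Proof.
have [n sp] : exists n, (size p <= n)%N by exists (size p).
have [<-|xy _] := eqVneq x y.
  rewrite orbF => x0.
  elim: n p sp => [|n IH] p sp.
    exists 0; rewrite (size_poly_leq0P _ sp).
    by rewrite /twist_diff comp_poly0 !scaler0 subrr.
  have cX : (twist_diff x x 'X^(n.+1))`_n = x * n.+1%:R.
    rewrite twist_diffE subrr scale0r add0r coefZ; congr (_ * _).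
    rewrite /twist_diff !scale1r comp_Xn_poly coefB coefXn ltn_eqF// subr0.
    rewrite addrC exprDn coef_sum (bigD1 (@inord n.+1 n))//= big1 => [|i].
      by rewrite inordK// expr1n mul1r coefMn coefXn eqxx addr0 binSn.
    rewrite -val_eqE /= inordK// expr1n mul1r coefMn coefXn eq_sym.
    by move=> /negPf->; rewrite mul0rn.
  (* Subtract the image of a multiple of X^(n+1) to lower the degree of p. *)
  have [|r hr] := IH (p - (p`_n / (x * n.+1%:R)) *: twist_diff x x 'X^(n.+1)).
    apply/leq_sizeP => j; rewrite leq_eqVlt coefB coefZ => /predU1P[<-|nj].
      by rewrite cX divfK ?subrr// mulf_neq0// pnatr_eq0.
    have sX : (size (twist_diff x x 'X^(n.+1)) <= j)%N.
      by apply: leq_trans (size_twist_diff_eq _ _) _; rewrite size_polyXn.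
    by rewrite (nth_default 0 (leq_trans sp nj)) (nth_default 0 sX) mulr0 subr0.
  exists (r + (p`_n / (x * n.+1%:R)) *: 'X^(n.+1)).
  by rewrite twist_diffD twist_diffZ hr subrK.
elim: n p sp => [|n IH] p sp.
  exists 0; rewrite (size_poly_leq0P _ sp).
  by rewrite /twist_diff comp_poly0 !scaler0 subrr.
have [|r hr] := IH (twist_diff 1 1 p).
  by apply: leq_trans (size_twist_diff11 _) _; case: (size p) sp.
(* Writing D for the forward difference, the image of p - x r is
   (x - y) p + x D p - x D p. *)
exists ((x - y)^-1 *: (p - x *: r)).
rewrite twist_diffZ -scaleNr twist_diffD twist_diffZ hr twist_diffE scaleNr.
by rewrite addrK scalerA mulVf ?scale1r// subr_eq0.
Qed.
End TwistedDifference.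

(** * Linear recurrences and quasi-polynomials *)

Section QuasiPolynomials.
Context {K : numFieldType}.
Implicit Types (x y mu : K) (r g : {poly K}) (u : nat -> K).
Implicit Types (S : seq K) (p : K -> {poly K}).

Definition quasi_poly S p n : K := \sum_(x <- S) (p x).[n%:R] * x ^+ n.

Lemma quasi_poly_shift S p y n :
  quasi_poly S p n.+1 - y * quasi_poly S p n =
  quasi_poly S (fun x => twist_diff x y (p x)) n.
Proof.
rewrite /quasi_poly mulr_sumr -sumrB; apply: eq_bigr => x _.
by rewrite horner_twist_diff mulrBl exprS !mulrA [_ * x]mulrC.
Qed.

(** First-order inhomogeneous recurrences stay within quasi-polynomials: a
particular solution is found for each base x separately, and any two solutions
differ by a multiple of mu^n. *)
Lemma quasi_poly_solve S mu u N : uniq S -> mu \in S -> 0 \notin S ->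
  (exists p, forall n, (N <= n)%N -> u n.+1 - mu * u n = quasi_poly S p n) ->
  exists p, forall n, (N <= n)%N -> u n = quasi_poly S p n.
Proof.
move=> uS muS S0 [p hp].
have mu0 : mu != 0 by apply: contraNneq S0 => <-.
have /choice[r hr] x : exists r, x \in S -> twist_diff x mu r = p x.
  have [xS|] := boolP (x \in S); last by exists 0.
  have [|r hr] := @twist_diff_surj _ x mu (p x); last by exists r.
  by apply/orP; left; apply: contraNneq S0 => <-.
pose c n := u n - quasi_poly S r n.
have cS n : (N <= n)%N -> c n.+1 = mu * c n.
  move=> Nn; apply/eqP; rewrite -subr_eq0.
  have -> : c n.+1 - mu * c n = (u n.+1 - mu * u n)
      - (quasi_poly S r n.+1 - mu * quasi_poly S r n) by rewrite /c; ring.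
  rewrite hp// quasi_poly_shift subr_eq0; apply/eqP.
  by apply: eq_big_seq => x xS; rewrite hr.
have cE n : (N <= n)%N -> c n = c N / mu ^+ N * mu ^+ n.
  elim: n => [|n IH].
    by rewrite leqn0 => /eqP->; rewrite expr0 divr1 mulr1.
  rewrite leq_eqVlt => /predU1P[<-|Nn]; first by rewrite divfK ?expf_neq0.
  by rewrite cS// IH// exprS mulrCA.
exists (fun x => r x + (if x == mu then (c N / mu ^+ N)%:P else 0)) => n Nn.
have -> : u n = quasi_poly S r n + c n by rewrite addrC subrK.
rewrite cE// /quasi_poly.
under [RHS]eq_bigr do rewrite hornerD mulrDl.
rewrite big_split/=; congr (_ + _).
rewrite (bigD1_seq mu)//= eqxx hornerC big1 ?addr0// => x /negPf->.
by rewrite horner0 mul0r.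
Qed.

(** The value at n of g(E) u, where E is the shift of sequences. *)
Definition shift_action g u n : K := \sum_(i < size g) g`_i * u (n + i)%N.

Lemma shift_action_widen g u n m : (size g <= m)%N ->
  shift_action g u n = \sum_(i < m) g`_i * u (n + i)%N.
Proof.
move=> gm; rewrite /shift_action.
rewrite (big_ord_widen _ (fun i => g`_i * u (n + i)%N) gm).
rewrite big_mkcond; apply: eq_bigr => i _.
by case: ltnP => // h; rewrite nth_default// mul0r.
Qed.

Lemma shift_action1 u n : shift_action 1 u n = u n.
Proof. by rewrite /shift_action size_poly1 big_ord1 coef1 mul1r addn0. Qed.

Lemma shift_actionZ c g u n :
  shift_action (c *: g) u n = c * shift_action g u n.
Proof.
rewrite (shift_action_widen _ _ (size_scale_leq c g)) /shift_action mulr_sumr.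
by apply: eq_bigr => i _; rewrite coefZ mulrA.
Qed.

Lemma shift_actionMXsubC x g u n :
  shift_action (('X - x%:P) * g) u n =
  shift_action g u n.+1 - x * shift_action g u n.
Proof.
rewrite (@shift_action_widen _ _ _ (size g).+1); last first.
  by rewrite (leq_trans (size_polyMleq _ _))// size_XsubC.
have -> : shift_action g u n = \sum_(i < (size g).+1) g`_i * u (n + i)%N.
  exact: shift_action_widen.
rewrite mulr_sumr.
under eq_bigr do rewrite mulrBl coefB coefXM coefCM mulrBl -mulrA.
rewrite sumrB; congr (_ - _).
rewrite big_ord_recl /= mul0r add0r; apply: eq_bigr => i _ /=.
by rewrite addSnnS.
Qed.

(** The recurrence is solved one linear factor at a time, which is why only
first-order equations have to be studied. *)
Lemma quasi_poly_of_recurrence S s u N : uniq S -> 0 \notin S ->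
  {subset s <= S} ->
  (forall n, (N <= n)%N -> shift_action (\prod_(x <- s) ('X - x%:P)) u n = 0) ->
  exists p, forall n, (N <= n)%N -> u n = quasi_poly S p n.
Proof.
move=> uS S0 sS hu.
have {hu} : exists p, forall n, (N <= n)%N ->
    shift_action (\prod_(x <- s) ('X - x%:P)) u n = quasi_poly S p n.
  exists (fun=> 0) => n Nn; rewrite hu// /quasi_poly big1// => x _.
  by rewrite horner0 mul0r.
elim: s sS => [|x s IH] sS [p hp].
  by exists p => n Nn; rewrite -hp// big_nil shift_action1.
apply: IH => [y ys|]; first by apply: sS; rewrite inE ys orbT.
apply: (@quasi_poly_solve _ x) => //; first by rewrite sS ?mem_head.
by exists p => n Nn; rewrite -hp// big_cons shift_actionMXsubC.
Qed.

(** A single term keeps the exact order n^(deg p_mu) |mu|^n, without the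
cancellation that the whole sum may undergo.  A factor E - y strictly
lowers the size of a nonzero polynomial attached to y and preserves the sizes of
the others, so the induction is on the total size of the polynomials not
attached to mu. *)
Lemma quasi_poly_isolate S p u N mu : uniq S -> mu \in S ->
  (forall n, (N <= n)%N -> u n = quasi_poly S p n) ->
  exists g r, size r = size (p mu) /\
    forall n, (N <= n)%N -> shift_action g u n = r.[n%:R] * mu ^+ n.
Proof.
move=> uS muS hu.
have {hu} : forall n, (N <= n)%N -> shift_action 1 u n = quasi_poly S p n.
  by move=> n Nn; rewrite shift_action1 hu.
move: 1 => h.
have [k] := ubnP (\sum_(x <- S | x != mu) size (p x)).
elim: k h p => // k IH h p pk hp.
have [/hasP[y yS /andP[ymu py]]|/hasPn p0] :=
    boolP (has (fun y => (y != mu) && (p y != 0)) S); last first.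
  exists h, (p mu); split => // n Nn; rewrite hp// /quasi_poly.
  rewrite (bigD1_seq mu)//= big1_seq ?addr0// => x /andP[xmu xS].
  by have := p0 x xS; rewrite xmu /= negbK => /eqP->; rewrite horner0 mul0r.
have [||g [r [sr hr]]] := IH (('X - y%:P) * h) (fun x => twist_diff x y (p x)).
- rewrite -ltnS; apply: leq_trans pk; rewrite ltnS.
  have yS' : y \in [seq x <- S | x != mu] by rewrite mem_filter ymu.
  have uS' : uniq [seq x <- S | x != mu] by rewrite filter_uniq.
  rewrite -[X in (X < _)%N]big_filter -[X in (_ < X)%N]big_filter.
  rewrite [X in (X < _)%N](bigD1_seq y)//= [X in (_ < X)%N](bigD1_seq y)//=.
  rewrite -addSn leq_add//.
    rewrite (leq_ltn_trans (size_twist_diff_eq _ _))//.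
    by rewrite prednK// size_poly_gt0.
  by apply: leq_sum => x xy; rewrite size_twist_diff_neq.
- by move=> n Nn; rewrite shift_actionMXsubC !hp// ?quasi_poly_shift// ltnW.
by exists g, r; split => //; rewrite sr size_twist_diff_neq// eq_sym.
Qed.

End QuasiPolynomials.

(** If the series is p / q, the recurrence is given by the reversal of q.  Its
constant coefficient is the leading coefficient of q, so 0 is not a root. *)
Lemma rational_recurrence (K : numClosedFieldType) (u : nat -> K) :
  rational_series u ->
  exists (s : seq K) N, 0 \notin s /\
    forall n, (N <= n)%N -> shift_action (\prod_(x <- s) ('X - x%:P)) u n = 0.
Proof.
move=> [p [q [q0 hq]]].
pose d := (size q).-1; pose P := \poly_(j < d.+1) q`_(d - j).
have P0 : P`_0 != 0 by rewrite coef_poly subn0 -lead_coefE lead_coef_eq0.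
have sq : size q = d.+1 by rewrite prednK// size_poly_gt0.
have actP n : (size p <= n)%N -> shift_action P u n = 0.
  move=> pn; rewrite (@shift_action_widen _ _ _ _ d.+1) ?size_poly//.
  have : p`_(n + d) = 0 by rewrite nth_default// (leq_trans pn)// leq_addr.
  rewrite -hq -(big_mkord xpredT (fun i => q`_i * u (n + d - i)%N)).
  rewrite (big_cat_nat (n := d.+1))//=; last by rewrite ltnS leq_addl.
  rewrite [X in _ + X]big1_seq ?addr0; last first.
    move=> i; rewrite mem_index_iota => /andP[_ /andP[di _]].
    by rewrite nth_default ?mul0r// sq.
  rewrite big_mkord (reindex_inj rev_ord_inj)/= => h; rewrite -[RHS]h.
  apply: eq_bigr => -[i id] _ /=; rewrite coef_poly id subSS.
  by rewrite -addnBA ?leq_subr// subKn.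
have Pn0 : P != 0 by apply: contraNneq P0 => ->; rewrite coef0.
have [s hs] := closed_field_poly_normal P.
exists s, (size p); split=> [|n pn].
  apply: contraNN P0 => s0; rewrite -horner_coef0 hs hornerZ.
  by rewrite (_ : _.[0] = 0) ?mulr0//; apply/rootP; rewrite root_prod_XsubC.
have := actP _ pn; rewrite hs shift_actionZ => /eqP.
by rewrite mulf_eq0 lead_coef_eq0 (negPf Pn0) => /eqP.
Qed.

(** * Growth of quasi-polynomial terms *)

Section Modulus.
Context {R : realType}.
Implicit Types (x : R[i]) (p r : {poly R[i]}).
Local Open Scope complex_scope.

Lemma normE x : `|x| = (normc x)%:C.
Proof. by case: x. Qed.

Lemma normc_ge0 x : 0 <= normc x.
Proof. by rewrite -lecR -normE normr_ge0. Qed.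

Lemma normcX x n : normc (x ^+ n) = normc x ^+ n.
Proof. by elim: n => [|n IH]; rewrite ?expr0 ?normc1// !exprS normcM IH. Qed.

Lemma normc_nat n : normc (n%:R : R[i]) = n%:R.
Proof.
by apply/eqP; rewrite -(inj_eq (@complexI R)) -normE rmorph_nat normr_nat.
Qed.

Lemma normc_sum (I : Type) (s : seq I) (P : pred I) (F : I -> R[i]) :
  normc (\sum_(i <- s | P i) F i) <= \sum_(i <- s | P i) normc (F i).
Proof.
rewrite -lecR -normE rmorph_sum/=; under [leRHS]eq_bigr do rewrite -normE.
exact: ler_norm_sum.
Qed.
End Modulus.

Section Asymptotics.
Context {R : realType}.
Implicit Types (x : R[i]) (p r : {poly R[i]}).

(** The extra factor n makes the statement usable for the part of lower order of
a polynomial, k = 0 included. *)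
Lemma poly_growth_le p k : (size p <= k)%N ->
  exists M : R, forall n, (0 < n)%N -> normc p.[n%:R] * n%:R <= M * n%:R ^+ k.
Proof.
move=> pk; exists (\sum_(i < size p) normc p`_i) => n n0.
rewrite horner_coef (le_trans (ler_wpM2r _ (normc_sum _ _ _)))//.
rewrite !mulr_suml ler_sum// => i _.
rewrite normcM normcX normc_nat -mulrA -exprSr ler_wpM2l ?normc_ge0//.
by rewrite ler_weXn2l ?ler1n// (leq_trans (ltn_ord i)).
Qed.

Lemma poly_growth_ge r k : size r = k.+1 ->
  exists c N, 0 < c /\
    forall n, (N <= n)%N -> c * n%:R ^+ k <= normc r.[n%:R] :> R.
Proof.
move=> sr; pose r' := r - r`_k *: 'X^k.
have [|M hM] := @poly_growth_le r' k.
  apply/leq_sizeP => j; rewrite coefB coefZ coefXn leq_eqVlt => /predU1P[<-|kj].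
    by rewrite eqxx mulr1 subrr.
  by rewrite gtn_eqF// mulr0 subr0 nth_default// sr.
have c0 : 0 < normc r`_k.
  rewrite lt_neqAle normc_ge0 andbT eq_sym.
  apply: contraTneq (ltnSn k) => /eq0_normc rk.
  rewrite -leqNgt -sr; apply/leq_sizeP => j.
  by rewrite leq_eqVlt => /predU1P[<-//|kj]; rewrite nth_default// sr.
exists (normc r`_k / 2), (Num.bound `|2 * M / normc r`_k|).+1.
split=> [|n Nn]; first by rewrite divr_gt0.
have n0 : (0 < n)%N by exact: leq_ltn_trans Nn.
have nM : 2 * M <= normc r`_k * n%:R.
  rewrite [leRHS]mulrC -ler_pdivrMr// (le_trans (ler_norm _))// ltW//.
  by rewrite (lt_le_trans (archi_boundP _))// ler_nat ltnW.
have {hM nM} : normc r'.[n%:R] <= normc r`_k / 2 * n%:R ^+ k.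
  have n0' : (0 : R) < n%:R by rewrite ltr0n.
  rewrite -(ler_pM2r n0') (le_trans (hM n n0))// mulrAC ler_wpM2r ?exprn_ge0//.
  lra.
have : normc (r`_k * n%:R ^+ k) <= normc r.[n%:R] + normc r'.[n%:R].
  rewrite -(normcN r'.[n%:R]) (le_trans _ (le_normcD _ _))// /r'.
  by rewrite !hornerE opprB addrCA subrr addr0.
rewrite normcM normcX normc_nat; lra.
Qed.

(** Induction on k: with s the square root of rho, one factor n is absorbed by
n s^n <= 1 / (1 - s), and the other powers by s^n. *)
Lemma exp_decay (rho : R) k : 0 <= rho < 1 ->
  exists M : R, forall n, n%:R ^+ k * rho ^+ n <= M.
Proof.
elim: k rho => [|k IH] rho /andP[rho0 rho1].
  by exists 1 => n; rewrite expr0 mul1r exprn_ile1// ltW.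
have s1 : Num.sqrt rho < 1 by rewrite -sqrtr1 ltr_sqrt.
have [|M hM] := IH (Num.sqrt rho); first by rewrite sqrtr_ge0.
have M0 : 0 <= M by apply: le_trans (hM 1); rewrite expr1n mul1r sqrtr_ge0.
set s := Num.sqrt rho in s1 hM.
have s0 : 0 <= s by exact: sqrtr_ge0.
have hs n : n%:R * s ^+ n * (1 - s) <= 1.
  (* Each of the n terms of the geometric sum of s is at least s^n. *)
  have -> : n%:R * s ^+ n * (1 - s) = s ^+ n * \sum_(i < n) (1 - s).
    by rewrite sumr_const card_ord -mulr_natl; ring.
  have : s ^+ n * \sum_(i < n) (1 - s) <= \sum_(i < n) s ^+ i * (1 - s).
    rewrite mulr_sumr ler_sum// => i _; rewrite ler_wpM2r//.
      by rewrite subr_ge0 ltW.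
    by rewrite ler_wiXn2l ?(ltW s1)// ltnW.
  move/le_trans; apply; rewrite -mulr_suml mulrC -opprB mulNr -subrX1 opprB.
  by rewrite gerBl exprn_ge0.
exists (M / (1 - s)) => n.
have -> : rho = s ^+ 2 by rewrite sqr_sqrtr.
have s1' : 0 < 1 - s by rewrite subr_gt0.
rewrite ler_pdivlMr//.
have -> : n%:R ^+ k.+1 * (s ^+ 2) ^+ n * (1 - s) =
   (n%:R ^+ k * s ^+ n) * (n%:R * s ^+ n * (1 - s)).
  by rewrite -exprM mulnC exprM exprS expr2; ring.
rewrite -[leRHS]mulr1 ler_pM//; by rewrite !mulr_ge0 ?exprn_ge0 ?ler0n// ltW.
Qed.

(** A term whose pair (modulus, degree) is lexicographically at most (lambda, k)
is dominated by n^k lambda^n. *)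
Lemma term_growth_le p x k (lambda : R) : 0 < lambda ->
  (normc x < lambda) || (normc x == lambda) && (size p <= k.+1)%N ->
  exists M : R, forall n, (0 < n)%N ->
    normc (p.[n%:R] * x ^+ n) <= M * n%:R ^+ k * lambda ^+ n.
Proof.
move=> l0; have ln n : 0 <= lambda ^+ n by rewrite exprn_ge0// ltW.
move=> /orP[xl|/andP[/eqP xl pk]]; last first.
  have [M hM] := poly_growth_le pk; exists M => n n0.
  rewrite normcM normcX xl ler_wpM2r//.
  have n0' : (0 : R) < n%:R by rewrite ltr0n.
  by rewrite -(ler_pM2r n0') -mulrA -exprSr hM.
have xl0 : 0 <= normc x / lambda by rewrite divr_ge0 ?normc_ge0 ?(ltW l0).
have [M hM] := @poly_growth_le p (size p) (leqnn _).
have [|M' hM'] := @exp_decay (normc x / lambda) (size p).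
  by rewrite xl0 ltr_pdivrMr// mul1r.
exists (`|M| * M') => n n0; rewrite normcM normcX.
have nk : (1 : R) <= n%:R ^+ k by rewrite exprn_ege1// ler1n.
have px : normc p.[n%:R] <= `|M| * n%:R ^+ size p.
  rewrite (le_trans _ (le_trans (hM n n0) _)) ?ler_wpM2r ?ler_norm ?exprn_ge0//.
  by rewrite ler_peMr ?normc_ge0// ler1n.
have -> : normc x = normc x / lambda * lambda by rewrite divfK// gt_eqF.
rewrite exprMn mulrA ler_wpM2r//.
apply: (@le_trans _ _ (`|M| * M')).
  rewrite (le_trans (ler_wpM2r (exprn_ge0 n xl0) px))//.
  by rewrite -mulrA ler_wpM2l.
have M0 : 0 <= M'.
  by apply: le_trans (hM' 1); rewrite mulr_ge0 ?exprn_ge0.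
by rewrite ler_peMr// mulr_ge0.
Qed.
End Asymptotics.

(** * Submultiplicative sequences with rational generating series *)

Lemma seq_argmax (T : eqType) d (U : orderType d) (F : T -> U) (s : seq T) :
  s != [::] -> exists2 x, x \in s & forall y, y \in s -> (F y <= F x)%O.
Proof.
elim: s => // a [|b s] IH _.
  by exists a; rewrite ?mem_head// => y; rewrite inE => /eqP->.
have [//|x xs hx] := IH; have [ax|/ltW xa] := leP (F a) (F x).
  by exists x => [|y]; rewrite inE ?xs ?orbT// => /predU1P[->//|/hx].
exists a => [|y]; rewrite ?mem_head// inE => /predU1P[->//|/hx yx].
exact: le_trans yx xa.
Qed.

Lemma bound_of_eventual_bound (R : realType) (v : nat -> R) N D :
  (forall n, (N <= n)%N -> v n <= D) ->
  exists2 D', 0 < D' & forall n, v n <= D'.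
Proof.
elim: N D => [|N IH] D hD.
  exists (`|D| + 1) => [|n]; first by rewrite ltr_wpDl.
  by rewrite (le_trans (hD n isT))// (le_trans (ler_norm D))// lerDl.
apply: (IH (Num.max D (v N))) => n; rewrite leq_eqVlt => /predU1P[<-|/hD h].
  by rewrite le_max lexx orbT.
by rewrite le_max h.
Qed.

Lemma sum_bound (R : realType) (T : eqType) (S : seq T) (F : T -> nat -> R)
    (w : nat -> R) :
  (forall x, x \in S -> exists M, forall n, (0 < n)%N -> F x n <= M * w n) ->
  exists M, forall n, (0 < n)%N -> \sum_(x <- S) F x n <= M * w n.
Proof.
elim: S => [|x S IH] h.
  by exists 0 => n _; rewrite big_nil mul0r.
have [M1 h1] := h x (mem_head _ _).
have [|M2 h2] := IH; first by move=> y yS; apply: h; rewrite inE yS orbT.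
by exists (M1 + M2) => n n0; rewrite big_cons mulrDl lerD ?h1 ?h2.
Qed.

Lemma submultiplicative_rational_growth (R : realType) (f : nat -> nat) :
  (forall n, (0 < f n)%N) -> (forall m n, (f (m + n) <= f m * f n)%N) ->
  rational_series (fun n => (f n)%:R : R[i]) ->
  exists (alpha : nat) (lambda C D : R),
    [/\ 1 <= lambda, 0 < C, C < D &
      forall n : nat, (1 <= n)%N ->
        C * n%:R ^+ alpha * lambda ^+ n <= (f n)%:R /\
        (f n)%:R <= D * n%:R ^+ alpha * lambda ^+ n].
Proof.
move=> f0 fM /rational_recurrence[s [N [s0 hs]]].
pose S := undup s; set u := (fun n => _ : R[i]) in hs.
have uS : uniq S by exact: undup_uniq.
have S0 : 0 \notin S by rewrite mem_undup.
have [|p hp] := quasi_poly_of_recurrence uS S0 _ hs.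
  by move=> x; rewrite mem_undup.
have fR n : 0 < (f n)%:R :> R by rewrite ltr0n.
have normu n : normc (u n) = (f n)%:R by exact: normc_nat.
(* The order on *l is lexicographic: first the modulus, then the degree. *)
pose F x : R *l nat := (normc x, size (p x)).
(* Some p x is nonzero, as otherwise u N would vanish. *)
have /(seq_argmax F)[mu] : [seq x <- S | p x != 0] != [::].
  apply/eqP => /(congr1 (fun t => \sum_(x <- t) (p x).[N%:R] * x ^+ N)).
  rewrite big_nil big_filter => h.
  have : u N = 0.
    rewrite hp// /quasi_poly (bigID (fun x => p x != 0))/= h add0r big1// => x.
    by rewrite negbK => /eqP->; rewrite horner0 mul0r.
  by move/eqP; rewrite pnatr_eq0 -leqn0 leqNgt f0.
rewrite mem_filter => /andP[pmu muS] hmu.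
pose lambda := normc mu; pose alpha := (size (p mu)).-1.
have sp : size (p mu) = alpha.+1 by rewrite prednK// size_poly_gt0.
have l0 : 0 < lambda.
  rewrite lt_neqAle normc_ge0 andbT eq_sym.
  by apply: contraNneq S0 => /eq0_normc <-.
pose w n : R := n%:R ^+ alpha * lambda ^+ n.
have w0 n : (0 < n)%N -> 0 < w n.
  by move=> n0; rewrite mulr_gt0// exprn_gt0// ltr0n.
have [M hM] : exists M, forall n, (0 < n)%N ->
    \sum_(x <- S) normc ((p x).[n%:R] * x ^+ n) <= M * w n.
  apply: sum_bound => x xS.
  have [px|px] := eqVneq (p x) 0.
    by exists 0 => n _; rewrite px horner0 mul0r normc0 mul0r.
  have [|M hM] := @term_growth_le R (p x) x alpha lambda l0.
    have := hmu x; rewrite mem_filter px xS => /(_ isT).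
    rewrite lexi_pair -sp -/lambda => /andP[h1 h2].
    move: h1 h2; rewrite le_eqVlt => /predU1P[->|-> //].
    by rewrite eqxx lexx /= leEnat => ->; rewrite orbT.
  by exists M => n n0; rewrite mulrA hM.
have upper n : (N.+1 <= n)%N -> (f n)%:R <= M * w n.
  move=> Nn; rewrite -normu (hp n (ltnW Nn)).
  apply: le_trans (normc_sum _ _ _) _; apply: hM; exact: leq_ltn_trans Nn.
have [g [r [sr hr]]] := quasi_poly_isolate uS muS hp.
rewrite sp in sr; have [c [N' [c0 hc]]] := poly_growth_ge sr.
pose A := \sum_(i < size g) normc g`_i * (f i)%:R.
have lower n : (maxn N N' <= n)%N -> c * w n <= A * (f n)%:R.
  rewrite geq_max => /andP[Nn N'n]; rewrite mulrA.
  rewrite (le_trans (ler_wpM2r (exprn_ge0 n (ltW l0)) (hc n N'n)))//.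
  rewrite /lambda -normcX -normcM -hr//.
  apply: le_trans (normc_sum _ _ _) _.
  rewrite mulr_suml ler_sum// => i _; rewrite normcM normu -mulrA.
  by rewrite ler_wpM2l ?normc_ge0// -natrM ler_nat addnC fM.
have l1 : 1 <= lambda.
  rewrite leNgt; apply/negP => l1.
  have [|M' hM'] := @exp_decay _ lambda alpha.+1; first by rewrite (ltW l0).
  have hB n : (N.+1 <= n)%N -> n%:R <= `|M| * M'.
    move=> Nn; have n0 : (0 < n)%N by exact: leq_ltn_trans Nn.
    apply: (@le_trans _ _ (`|M| * (n%:R * w n))); last first.
      by rewrite ler_wpM2l// /w mulrA -exprS.
    rewrite mulrCA ler_peMr//.
    rewrite (le_trans _ (ler_wpM2r (ltW (w0 n n0)) (ler_norm M)))//.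
    by rewrite (le_trans _ (upper n Nn))// ler1n.
  pose B := `|M| * M'.
  have := hB (Num.bound `|B| + N.+1)%N (leq_addl _ _).
  apply/negP; rewrite -ltNge (le_lt_trans (ler_norm _))//.
  by rewrite (lt_le_trans (archi_boundP _))// ler_nat leq_addr.
(* Both ratios are bounded for large n, hence for all n.  The lower constant of
   the statement is the inverse of the second bound. *)
have [D D0 hD] : exists2 D, 0 < D & forall n, (f n)%:R / w n <= D.
  apply: (@bound_of_eventual_bound _ _ N.+1 M) => n Nn.
  by rewrite ler_pdivrMr ?upper// w0// (leq_ltn_trans _ Nn).
have [C C0 hC] : exists2 C, 0 < C & forall n, w n / (f n)%:R <= C.
  apply: (@bound_of_eventual_bound _ _ (maxn N N') (A / c)) => n Nn.
  by rewrite ler_pdivrMr// mulrAC ler_pdivlMr// mulrC lower.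
exists alpha, lambda, C^-1, (D + C^-1); split => //; first by rewrite invr_gt0.
  by rewrite ltrDr.
move=> n n0; rewrite -!mulrA -/(w n); split.
  by rewrite mulrC ler_pdivrMr// mulrC -ler_pdivrMr// hC.
rewrite (@le_trans _ _ (D * w n))//; first by rewrite -ler_pdivrMr ?w0.
by rewrite ler_wpM2r ?ltW ?w0// ltrDl invr_gt0.
Qed.

(** * Spheres in a finitely generated group *)

Section Spheres.
Context {G : groupType} {X : {fset G}} (Xgen : generates X).
Local Open Scope nat_scope.
Local Open Scope group_scope.
Local Open Scope classical_set_scope.

Lemma geodesicP g : exists w,
  [/\ is_word X w, \prod_(x <- w) x = g & size w = word_length X g].
Proof.
rewrite /word_length; case: pselect => [ex|[]]; last first.
  by have [n hn] := Xgen g; exists n; apply/asboolP.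
case: ex_minnP => n /asboolP[w [ww /eqP wg sw]] _.
by exists w.
Qed.

Lemma word_length_le w : is_word X w ->
  (word_length X (\prod_(x <- w) x) <= size w)%N.
Proof.
move=> ww; rewrite /word_length; case: pselect => [ex|//].
case: ex_minnP => n _; apply; apply/asboolP; exists w; split => //.
exact/eqP.
Qed.

(** Cut a geodesic after m letters.  The two pieces have length at most m and at
most n; if one were shorter, g would be too. *)
Lemma sphere_split m n g : word_length X g = (m + n)%N ->
  exists h k, [/\ g = h * k, word_length X h = m & word_length X k = n].
Proof.
have [w [ww <- sw]] := geodesicP g; rewrite -sw => swmn.
have := ww; rewrite -(cat_take_drop m w) /is_word all_cat => /andP[w1 w2].
have s1 : size (take m w) = m by rewrite size_takel// swmn leq_addr.
have s2 : size (drop m w) = n by rewrite size_drop swmn addKn.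
have l1 := word_length_le w1; have l2 := word_length_le w2.
exists (\prod_(x <- take m w) x), (\prod_(x <- drop m w) x).
rewrite -big_cat cat_take_drop.
have := swmn; rewrite sw.
have [v1 [vv1 v1E v1s]] := geodesicP (\prod_(x <- take m w) x).
have [v2 [vv2 v2E v2s]] := geodesicP (\prod_(x <- drop m w) x).
have := @word_length_le (v1 ++ v2).
rewrite /is_word all_cat -!/(is_word X _) vv1 vv2 => /(_ isT).
rewrite big_cat/= v1E v2E -big_cat cat_take_drop/= size_cat v1s v2s => le12 E.
rewrite s1 in l1; rewrite s2 in l2.
split=> //; apply/eqP; rewrite eqn_leq ?l1 ?l2 /=.
  by rewrite -(leq_add2r n) -E (leq_trans le12)// leq_add2l.
by rewrite -(leq_add2l m) -E (leq_trans le12)// leq_add2r.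
Qed.

Lemma sphere_add_sub m n :
  sphere X (m + n) `<=` (fun hk => hk.1 * hk.2) @` (sphere X m `*` sphere X n).
Proof. by move=> g /sphere_split[h [k [-> hm kn]]]; exists (h, k). Qed.

(** Spheres of radius 0 and 1 lie in the finite sets {1} and X together with the
inverses of X; the others are covered by products of smaller spheres. *)
Lemma finite_sphere n : finite_set (sphere X n).
Proof.
elim: n => [|n IH].
  apply: (@sub_finite_set _ _ [set 1]) => // g; rewrite /sphere /= => g0.
  have [w [_ wg]] := geodesicP g; rewrite g0 -wg => /size0nil->.
  by rewrite big_nil.
have f1 : finite_set (sphere X 1).
  pose Y := [set` X] `|` (fun x => x^-1) @` [set` X].
  have fY : finite_set Y.
    by rewrite finite_setU; split => //; exact: finite_image.
  apply: sub_finite_set fY => g; rewrite /sphere /= => g1.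
  have [w [+ wg]] := geodesicP g; rewrite g1 -{}wg; case: w => [//|x [|//]]/=.
  rewrite andbT big_seq1 => /orP[xX|xX] _; first by left.
  by right; exists x^-1; rewrite ?invgK.
rewrite -add1n; apply: sub_finite_set (@sphere_add_sub 1 n) _.
exact: finite_image (finite_setX f1 IH).
Qed.

Lemma sphere_size_submul m n :
  (sphere_size X (m + n) <= sphere_size X m * sphere_size X n)%N.
Proof.
rewrite /sphere_size.
rewrite -(size_allpairs (fun h k => h * k)); apply: uniq_leq_size => // g.
rewrite in_fset_set ?inE; last exact: finite_sphere.
move=> /sphere_split[h [k [-> hm kn]]]; apply: allpairs_f.
  by rewrite in_fset_set ?inE//; exact: finite_sphere.
by rewrite in_fset_set ?inE//; exact: finite_sphere.
Qed.

(** If the sphere of radius n were empty, splitting would leave no element of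
length at least n, and the group would be a finite union of spheres. *)
Lemma sphere_size_gt0 n : infinite_set [set: G] -> (0 < sphere_size X n)%N.
Proof.
move=> Ginf; rewrite lt0n; apply/eqP => /cardfs0_eq s0.
have {s0} s0 : sphere X n = set0.
  by rewrite -(fset_setK (finite_sphere n)) s0 set_fset0.
apply: Ginf; apply: (@sub_finite_set _ _ (\bigcup_(i in `I_n) sphere X i)).
  move=> g _; exists (word_length X g) => //=; rewrite ltnNge; apply/negP => ng.
  have [h [k [_ hn _]]] :=
    @sphere_split n (word_length X g - n) g (esym (subnKC ng)).
  by have : sphere X n h by []; rewrite s0.
by apply: bigcup_finite => [|i _]; [exact: finite_II|exact: finite_sphere].
Qed.
End Spheres.

(** * Growth of spheres *)

Theorem theorem1 (R : realType) (G : groupType) (X : {fset G})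
    (Ginf : infinite_set [set: G]%classic)
    (Xgen : generates X)
    (srat : rational_series (fun n => (sphere_size X n)%:R : R[i])) :
  exists (alpha : nat) (lambda C D : R),
    [/\ 1 <= lambda, 0 < C, C < D &
      forall n : nat, (1 <= n)%N ->
        C * n%:R ^+ alpha * lambda ^+ n <= (sphere_size X n)%:R /\
        (sphere_size X n)%:R <= D * n%:R ^+ alpha * lambda ^+ n].
Proof.
by apply: submultiplicative_rational_growth srat => [n|m n];
  [exact: sphere_size_gt0 | exact: sphere_size_submul].
Qed.
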